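(* Let $s,t\ge1$ and $D\ge3$ be integers and let $\ell=2\lceil\log s/\log(D-1)\rceil+3$. Let $\mathcal G=\{G_1,\dots,G_t\}$ be an $s$-joined graph family on $n$ vertices. Let $\mathcal H$ be a $[t]$-edge-colored graph with $\Delta^{mon}(\mathcal H)\le D$ and $|V(\mathcal H)|\le n-6sD$, and let $\mathcal H_0\subseteq\mathcal H$ be a rooted $[t]$-edge-colored subgraph such that $\mathcal H$ is $\mathcal H_0$-path-constructible with all paths $P_1,\dots,P_k$ of length at least $\ell$. If $\phi:\mathcal H_0\hookrightarrow\mathcal G$ is a $(2s,D)$-good embedding, then there is a root set for $\mathcal H$ containing the roots of $\mathcal H_0$ that makes $\mathcal H$ a rooted graph, together with a $(2s,D)$-good embedding $\phi':\mathcal H\hookrightarrow\mathcal G$ extending $\phi$.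
   Context: A graph family $\mathcal G=\{G_1,\dots,G_t\}$ is a collection of $t$ simple graphs on a common finite vertex set $V$, $n=|V|$. For $X\subseteq V\times[t]$, $\Gamma_{\mathcal G}(X)=\bigcup_{(v,i)\in X}\{u\in V:uv\in E(G_i)\}$. The family is $s$-joined if for all $X\subseteq V\times[t]$ and $Y\subseteq V$ with $|X|\ge s$ and $|Y|\ge s$ there exist $(v,i)\in X$ and $y\in Y$ with $vy\in E(G_i)$. A $[t]$-edge-colored graph $\mathcal H$ is a simple graph with each edge colored in $[t]$; $H_i$ is its spanning subgraph of color-$i$ edges, $\deg_{H_i}(h)$ the number of color-$i$ edges at $h$, and $\Delta^{mon}(\mathcal H)=\max_i\max_h\deg_{H_i}(h)$. An embedding $\phi:\mathcal H\hookrightarrow\mathcal G$ is an injective map $V(\mathcal H)\to V$ with $\phi(x)\phi(y)\in E(G_i)$ for every edge $xy$ of color $i$. A rooted $[t]$-edge-colored graph is one with a distinguished set of roots such that, after deleting all edges with both ends roots, every connected component is a tree containing exactly one root; for a non-root $h$ the unique path from $h$ to the root set (meeting it only at its last vertex) determines the parent of $h$ (its neighbour on the path) and $c(h)$, the color of the edge from $h$ to its parent. For fixed $D$: $P_\phi(\mathcal H)=\{(\phi(h),c(h)):h\text{ non-root}\}$ and, for $X\subseteq V\times[t]$, $R(X,\phi)=|\Gamma_{\mathcal G}(X)\setminus\phi(V(\mathcal H))|-\sum_{(v,i)\in X}[D-\deg_{H_i}(\phi^{-1}(v))]-|P_\phi(\mathcal H)\cap X|$, with $\deg_{H_i}(\phi^{-1}(v))=0$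 if $v\notin\phi(V(\mathcal H))$. The embedding $\phi$ is $(s,D)$-good if $R(X,\phi)\ge0$ for every $X\subseteq V\times[t]$ with $|X|\le s$. For $\mathcal H_0\subseteq\mathcal H$, $\mathcal H$ is $\mathcal H_0$-path-constructible if there are edge-disjoint paths $P_1,\dots,P_k$ in $\mathcal H$ such that (i) $E(\mathcal H)=E(\mathcal H_0)\cup\bigcup_{j\in[k]}E(P_j)$; (ii) for each $i\in[k]$ the internal vertices of $P_i$ are disjoint from $V(\mathcal H_0)\cup\bigcup_{j<i}V(P_j)$; (iii) for each $i\in[k]$ at least one endpoint of $P_i$ lies in $V(\mathcal H_0)\cup\bigcup_{j<i}V(P_j)$. An embedding of $\mathcal H$ extends $\phi$ if it agrees with $\phi$ on $V(\mathcal H_0)$. *)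

(* Defs.v *)
From mathcomp Require Import all_boot all_order all_algebra.
From Stdlib Require Import ClassicalEpsilon.
Set Implicit Arguments. Unset Strict Implicit. Unset Printing Implicit Defensive.
Import Order.TTheory GRing.Theory Num.Theory.

Definition asb (P : Prop) : bool :=
  if excluded_middle_informative P then true else false.

Section Defs.
Variable t : nat.   (* colours are 'I_t, i.e. [t] shifted to {0,..,t-1} *)

Variable V : finType.

Definition graph_family (G : 'I_t -> rel V) :=
  forall i, symmetric (G i) /\ irreflexive (G i).

Definition Gamma (G : 'I_t -> rel V) (X : {set V * 'I_t}) : {set V} :=
  [set u | [exists x in X, G x.2 x.1 u]].

Definition s_joined (s : nat) (G : 'I_t -> rel V) :=
  forall (X : {set V * 'I_t}) (Y : {set V}), s <= #|X| -> s <= #|Y| ->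
    exists v i y, [/\ (v, i) \in X, y \in Y & G i v y].

(* c x y = Some i  iff  xy is an edge of colour i;  None iff not an edge *)
Variable W : finType.

Definition colgraph (Vs : {set W}) (c : W -> W -> option 'I_t) :=
  [/\ forall x y, c x y = c y x, forall x, c x x = None &
      forall x y, c x y != None -> (x \in Vs) && (y \in Vs)].

Definition adj (c : W -> W -> option 'I_t) : rel W := fun x y => c x y != None.

Definition cdeg (c : W -> W -> option 'I_t) (i : 'I_t) (x : W) : nat :=
  #|[set y | c x y == Some i]|.

Definition mon_deg_le (Vs : {set W}) (c : W -> W -> option 'I_t) (D : nat) :=
  forall i x, x \in Vs -> cdeg c i x <= D.

Definition colsubgraph (V0 : {set W}) (c0 : W -> W -> option 'I_t)
  (Vs : {set W}) (c : W -> W -> option 'I_t) :=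
  V0 \subset Vs /\ forall x y i, c0 x y = Some i -> c x y = Some i.

Definition redge (Rt : {set W}) (c : W -> W -> option 'I_t) : rel W :=
  fun x y => (c x y != None) && ~~ ((x \in Rt) && (y \in Rt)).

Definition acyclic (e : rel W) :=
  forall s : seq W, uniq s -> 3 <= size s -> ~~ cycle e s.

(* after deleting root-root edges every component is a tree with exactly one
   root: the remaining graph is a forest and each vertex is connected to
   exactly one root *)
Definition rooted (Vs : {set W}) (c : W -> W -> option 'I_t) (Rt : {set W}) :=
  [/\ Rt \subset Vs, acyclic (redge Rt c) &
      forall v, v \in Vs -> exists! r, r \in Rt /\ connect (redge Rt c) v r].

Definition root_path (Rt : {set W}) (c : W -> W -> option 'I_t) (h : W) (p : seq W) :=
  [&& path (redge Rt c) h p, uniq (h :: p), last h p \in Rt &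
      all (fun x => x \notin Rt) (belast h p)].

Definition col_to_parent (Rt : {set W}) (c : W -> W -> option 'I_t) (h : W) (i : 'I_t) :=
  exists p, root_path Rt c h p /\ c h (head h p) = Some i.

Definition Pset (Vs : {set W}) (c : W -> W -> option 'I_t) (Rt : {set W})
  (phi : W -> V) : {set V * 'I_t} :=
  [set x | asb (exists h, [/\ h \in Vs :\: Rt, phi h = x.1 & col_to_parent Rt c h x.2])].

Definition embeds (G : 'I_t -> rel V) (Vs : {set W}) (c : W -> W -> option 'I_t)
  (phi : W -> V) :=
  {in Vs &, injective phi} /\ forall x y i, c x y = Some i -> G i (phi x) (phi y).

(* deg_{H_i}(phi^{-1}(v)), which is 0 if v is not in phi(V(H))
   (phi is injective on Vs, so the sum has at most one term) *)
Definition degphi (Vs : {set W}) (c : W -> W -> option 'I_t) (phi : W -> V)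
  (i : 'I_t) (v : V) : nat :=
  \sum_(h in Vs | phi h == v) cdeg c i h.

Definition Rval (G : 'I_t -> rel V) (Vs : {set W}) (c : W -> W -> option 'I_t)
  (Rt : {set W}) (phi : W -> V) (D : nat) (X : {set V * 'I_t}) : int :=
  (#|Gamma G X :\: phi @: Vs|%:Z
   - \sum_(x in X) (D%:Z - (degphi Vs c phi x.2 x.1)%:Z)
   - #|Pset Vs c Rt phi :&: X|%:Z)%R.

Definition good (G : 'I_t -> rel V) (Vs : {set W}) (c : W -> W -> option 'I_t)
  (Rt : {set W}) (phi : W -> V) (s D : nat) :=
  forall X : {set V * 'I_t}, #|X| <= s -> (0 <= Rval G Vs c Rt phi D X)%R.

Definition is_path (c : W -> W -> option 'I_t) (p : seq W) :=
  if p is x :: q then path (adj c) x q && uniq p else false.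

Definition plength (p : seq W) := (size p).-1.

Definition pedge (p : seq W) (x y : W) :=
  ((x, y) \in zip p (behead p)) || ((y, x) \in zip p (behead p)).

Definition internal (p : seq W) : seq W :=
  if p is x :: q then behead (belast x q) else [::].

Definition endpoints (p : seq W) : seq W :=
  if p is x :: q then [:: x; last x q] else [::].

Definition prior (V0 : {set W}) (Ps : seq (seq W)) (i : nat) (v : W) :=
  (v \in V0) || has (fun j => v \in nth [::] Ps j) (iota 0 i).

Definition path_constructible_with (V0 : {set W}) (c0 : W -> W -> option 'I_t)
  (c : W -> W -> option 'I_t) (Ps : seq (seq W)) :=
  [/\ forall j, j < size Ps -> is_path c (nth [::] Ps j),
      forall j1 j2 x y, j1 < size Ps -> j2 < size Ps -> j1 != j2 ->
        pedge (nth [::] Ps j1) x y -> ~~ pedge (nth [::] Ps j2) x y,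
      forall x y, adj c x y <->
        (adj c0 x y \/ exists2 j, j < size Ps & pedge (nth [::] Ps j) x y),
      forall i v, i < size Ps -> v \in internal (nth [::] Ps i) -> ~~ prior V0 Ps i v
    &
      forall i, i < size Ps -> has (prior V0 Ps i) (endpoints (nth [::] Ps i))].

End Defs.

(* l = 2 * ceil(log s / log (D-1)) + 3; for D >= 3 and s >= 1,
   ceil(log s / log(D-1)) is the least e with s <= (D-1)^e, i.e. up_log (D-1) s *)
Definition ell (s D : nat) : nat := (up_log (D - 1) s).*2 + 3.

(* Main.v *)
(* Declaring every vertex of H a root is always a legal rooting and empties
   P_phi, so goodness only gets weaker; it then reads: for all |X| <= 2s, the sum
   over X of the demands D - deg is at most |Gamma(X) \ U|, U being the image.
   The proof works with an arbitrary demand function f on V x [t], which allows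
   partial embeddings to be handled through U and f alone.

   Sets X attaining equality have fewer than s elements (by joinedness) and are
   closed under union (by submodularity). As in Friedman-Pippenger, this gives a
   neighbour of v in G_i that can be added to U while f(v, i) drops by one, and
   also an isolated vertex that can be added. Conversely such an addition can be
   undone. A path of length at least l is embedded between two vertices by growing
   a (D-1)-ary tree with at least s leaves from each of them, linking two leaves
   by joinedness, and rolling back all tree edges off the resulting path. Since
   isolated vertices can be added at will, both endpoints of each P_i may be
   assumed to be embedded already. *)
Require Import Defs.
From mathcomp Require Import all_boot all_order all_algebra.
From mathcomp Require Import zify.
Set Implicit Arguments. Unset Strict Implicit. Unset Printing Implicit Defensive.
Import Order.TTheory GRing.Theory Num.Theory.

(** * Demands, critical sets, and adding a single vertex *)

Section Extendability.

Variables (s t D : nat) (V : finType) (G : 'I_t -> rel V).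

Implicit Types (U : {set V}) (X Y : {set V * 'I_t}).
Implicit Types (f g : V * 'I_t -> nat) (T P : seq (V * 'I_t * V)).

Definition extendable U f :=
  forall X, #|X| <= 2 * s ->
    \sum_(x in X) f x <= #|Gamma G X :\: U|.

(** By the last clause a vertex enters [U] with full demand, so trees can branch again at new
    leaves. *)
Definition state U f :=
  [/\ extendable U f, forall p, f p <= D &
      forall v i, v \notin U -> f (v, i) = D].

Definition critical U f X :=
  (#|X| <= 2 * s) && (\sum_(x in X) f x == #|Gamma G X :\: U|).

Lemma extendable_mono U f g :
  (forall p, g p <= f p) -> extendable U f -> extendable U g.
Proof. by move=> gf ext X /ext; apply: leq_trans; apply: leq_sum => x _. Qed.

Lemma eq_state U f g : f =1 g -> state U f -> state U g.
Proof.
move=> fg [ext fD foff]; split=> [|p|v i vU]; rewrite -?fg //; last exact: foff.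
by apply: extendable_mono ext => p; rewrite fg.
Qed.

Lemma GammaU X Y : Gamma G (X :|: Y) = Gamma G X :|: Gamma G Y.
Proof.
apply/setP=> u; rewrite !inE; apply/existsP/orP.
- by case=> x /andP[]; rewrite inE => /orP[] xX gx; [left|right];
    apply/existsP; exists x; rewrite xX.
- by case=> /existsP[x /andP[xX gx]]; exists x; rewrite inE xX ?orbT.
Qed.

Lemma Gamma_sub X Y : X \subset Y -> Gamma G X \subset Gamma G Y.
Proof. by move=> /setUidPr <-; rewrite GammaU subsetUl. Qed.

Lemma mem_Gamma X v i u : (v, i) \in X -> G i v u -> u \in Gamma G X.
Proof. by move=> vX gu; rewrite inE; apply/existsP; exists (v, i); rewrite vX. Qed.

Lemma Gamma0 : Gamma G set0 = set0.
Proof. by apply/setP=> u; rewrite !inE; apply/existsP=> -[x]; rewrite inE. Qed.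

Lemma sum_setUI f X Y :
  \sum_(x in X :|: Y) f x + \sum_(x in X :&: Y) f x
    = \sum_(x in X) f x + \sum_(x in Y) f x.
Proof.
rewrite (big_setID X (A := X :|: Y)) /= (big_setID X (A := Y)) /=.
by rewrite setUK setDUl setDv set0U setIC addnAC addnA.
Qed.

(** Submodularity: [Gamma] commutes with unions, and the [Gamma] of an intersection lies in both
    sets. *)
Lemma card_Gamma_setUI X Y U :
  #|Gamma G (X :|: Y) :\: U| + #|Gamma G (X :&: Y) :\: U|
    <= #|Gamma G X :\: U| + #|Gamma G Y :\: U|.
Proof.
rewrite GammaU setDUl -(cardsUI (Gamma G X :\: U)) leq_add2l; apply: subset_leq_card.
by rewrite subsetI !setSD // Gamma_sub ?subsetIl ?subsetIr.
Qed.

Section Budget.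

Hypotheses (s_gt0 : 0 < s) (joinedG : s_joined s G).
Variables (U : {set V}) (f : V * 'I_t -> nat).
Hypotheses (stU : state U f) (budget : #|U| + s + 2 * s * D <= #|V|).

(** If [X] had at least [s] elements, joinedness would leave fewer than [s] vertices outside
    [Gamma G X]. By the budget more than [2 * s * D] vertices of [Gamma G X] would then avoid [U],
    exceeding the total demand of [X]. *)
Lemma critical_small X : critical U f X -> #|X| < s.
Proof.
have [ext fD _] := stU; case/andP=> X2s /eqP sumX; rewrite ltnNge; apply/negP=> sX.
have Gc : #|~: Gamma G X| < s.
  rewrite ltnNge; apply/negP=> /(joinedG sX)[v [i [y [vX]]]].
  by rewrite inE => /negP yX gy; apply/yX/(mem_Gamma vX).
have sumD : \sum_(x in X) f x <= 2 * s * D.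
  apply: (@leq_trans (#|X| * D)); last by rewrite leq_mul2r X2s orbT.
  by rewrite -sum_nat_const leq_sum.
have := cardsC (Gamma G X); have := cardsID U (Gamma G X).
have := subset_leq_card (subsetIr (Gamma G X) U); lia.
Qed.

(** Both sets have fewer than [s] elements, so their union stays in the range [2 * s] of
    extendability. Demand is modular and supply submodular, hence equality passes to the union. *)
Lemma criticalU X Y : critical U f X -> critical U f Y -> critical U f (X :|: Y).
Proof.
have [ext _ _] := stU => cX cY.
have := critical_small cX; have := critical_small cY.
case/andP: cX cY => _ /eqP sX /andP[_ /eqP sY] sY' sX'.
have := cardsUI X Y => cXY.
have cU : #|X :|: Y| <= 2 * s by lia.
have cI : #|X :&: Y| <= 2 * s by lia.
rewrite /critical cU eqn_leq ext //= -(leq_add2r (\sum_(x in X :&: Y) f x)).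
rewrite sum_setUI sX sY; apply: leq_trans (card_Gamma_setUI X Y U).
by rewrite leq_add2l ext.
Qed.

Lemma critical0 : critical U f set0.
Proof. by rewrite /critical cards0 big_set0 Gamma0 set0D cards0. Qed.

Lemma critical_bigcup (P : pred {set V * 'I_t}) :
  critical U f (\bigcup_(X | critical U f X && P X) X).
Proof.
apply: (big_ind (critical U f)) => [||X /andP[]//]; first exact: critical0.
exact: criticalU.
Qed.

(** Taking [y] costs a set at most one vertex of its supply. A set with slack can afford this; a
    critical set that sees [y] pays by a drop in its demand. *)
Lemma extendable_addv g y :
  y \notin U -> (forall p, g p <= f p) ->
  (forall X, critical U f X -> y \in Gamma G X ->
     \sum_(x in X) g x < \sum_(x in X) f x) ->
  extendable (y |: U) g.
Proof.
have [ext _ _] := stU => yU gf crit X cX; have extX := ext _ cX.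
have sumgf : \sum_(x in X) g x <= \sum_(x in X) f x by apply: leq_sum.
have -> : Gamma G X :\: (y |: U) = (Gamma G X :\: U) :\ y.
  by rewrite setDDl [y |: U]setUC.
rewrite (cardsD1 y) inE yU /= in extX; case: (boolP (y \in _)) extX => [yX|_] extX.
  have [tight|slack] := eqVneq (\sum_(x in X) f x) #|Gamma G X :\: U|.
    by rewrite -ltnS (leq_trans (crit X _ yX)) // /critical cX tight eqxx.
  rewrite -ltnS (leq_ltn_trans sumgf) // ltn_neqAle extX andbT.
  by rewrite (cardsD1 y) inE yU yX in slack.
exact: leq_trans sumgf extX.
Qed.

(** Let [C] be the largest critical set avoiding [(v, i)]. If [Gamma G C] contained all
    [G i]-neighbours of [v] outside [U], adding [(v, i)] to [C] would raise demand but not supply.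
    For a neighbour [y] that [C] misses, every critical set seeing [y] contains [(v, i)] and so
    loses one unit of demand. *)
Lemma extend_leaf v i : v \in U -> 0 < f (v, i) ->
  exists y, [/\ y \notin U, G i v y &
    state (y |: U) (fun p => f p - (p == (v, i)))].
Proof.
have [ext fD foff] := stU => vU f0.
have [y [yU gy ycrit]] : exists y, [/\ y \notin U, G i v y &
    forall X, critical U f X -> (v, i) \notin X -> y \notin Gamma G X].
  set C := \bigcup_(X | critical U f X && ((v, i) \notin X)) X.
  have cC : critical U f C by exact: critical_bigcup.
  have viC : (v, i) \notin C by apply/bigcupP=> -[X /andP[_ /negP]].
  have sub : ~~ (Gamma G [set (v, i)] :\: U \subset Gamma G C :\: U).
    apply/negP=> /setUidPr sub.
    have cC1 : #|(v, i) |: C| <= 2 * s.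
      by rewrite cardsU1 viC (leq_trans (critical_small cC)) ?leq_pmull.
    have := ext _ cC1; rewrite big_setU1 //= GammaU setDUl sub.
    case/andP: cC => _ /eqP->.
    by rewrite -[leqRHS]add0n leq_add2r leqNgt f0.
  have /subsetPn[y] := sub; rewrite !inE => /andP[yU /existsP[[w j]]].
  rewrite inE => /andP[/eqP[-> ->] /= gy]; rewrite yU /= => yC.
  exists y; split=> // X cX vX; apply/negP=> yX; case/negP: yC.
  have /Gamma_sub/subsetP/(_ _ yX) : X \subset C by apply: (bigcup_sup X); rewrite cX vX.
  by rewrite inE.
exists y; split=> //; split=> [|p|w j].
- apply: extendable_addv => // [p|X cX yX]; first exact: leq_subr.
  have vX : (v, i) \in X by apply: contraLR yX; exact: ycrit.
  rewrite (big_setD1 _ vX) [X in _ < X](big_setD1 _ vX) /= eqxx.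
  rewrite -addSn subn1 prednK // leq_add2l.
  by apply: leq_sum => x _; apply: leq_subr.
- by have := fD p; lia.
- rewrite !inE negb_or => /andP[_ wU]; rewrite foff //.
  have -> : (w, j) == (v, i) = false; last exact: subn0.
  by apply: contraNF wU => /eqP[-> _].
Qed.

(** The union [C] of all critical sets is critical, so it has fewer than [s] elements and its supply
    is at most [s * D]. Hence some vertex outside [U] is seen by no critical set. *)
Lemma extend_isolated : exists2 y, y \notin U & state (y |: U) f.
Proof.
have [ext fD foff] := stU.
set C := \bigcup_(X | critical U f X && true) X.
have cC : critical U f C by exact: critical_bigcup.
have [y yUC] : exists y, y \notin U :|: Gamma G C.
  apply/existsP; rewrite -negb_forall; apply/negP=> /forallP all.
  have : #|U :|: Gamma G C| = #|V| by apply: eq_card => x; rewrite all.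
  have -> : U :|: Gamma G C = U :|: (Gamma G C :\: U).
    by apply/setP=> x; rewrite !inE; case: (x \in U).
  have := cardsUI U (Gamma G C :\: U).
  have := critical_small cC; case/andP: cC => _ /eqP <-.
  have : \sum_(x in C) f x <= #|C| * D by rewrite -sum_nat_const leq_sum.
  nia.
move: yUC; rewrite inE negb_or => /andP[yU yC].
exists y => //; split=> // [|v i]; last by rewrite !inE negb_or => /andP[_ /foff].
apply: extendable_addv => // X cX yX; case/negP: yC.
by apply: subsetP yX; apply: Gamma_sub; apply: (bigcup_sup X); rewrite cX.
Qed.

End Budget.

(** * Adding and undoing batches of edges *)

Definition grown U T : {set V} :=
  U :|: [set y in unzip2 T].

(** An entry [((v, i), y)] of [T] attaches the new vertex [y] to [v] in colour [i], charged to [v]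
    alone. *)
Definition spent f T : V * 'I_t -> nat :=
  fun p => f p - count_mem p (unzip1 T).

Definition is_edge (e : V * 'I_t * V) := G e.1.2 e.1.1 e.2.

(** Order and parents are left open, so that freshness survives permuting [T] and passing to a part
    of it. *)
Definition fresh U T :=
  [/\ uniq (unzip2 T), {in unzip2 T, forall y, y \notin U} & all is_edge T].

Lemma grown_nil U : grown U [::] = U.
Proof. by apply/setP=> x; rewrite !inE orbF. Qed.

Lemma grown_cons U e T : grown U (e :: T) = grown (e.2 |: U) T.
Proof. by apply/setP=> x; rewrite !inE orbA [(x \in U) || _]orbC. Qed.

Lemma grown_cat U T1 T2 : grown U (T1 ++ T2) = grown (grown U T1) T2.
Proof. by apply/setP=> x; rewrite !inE /unzip2 map_cat mem_cat orbA. Qed.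

Lemma spent_cons f e T :
  spent f (e :: T) =1 spent (fun p => f p - (p == e.1)) T.
Proof. by move=> p; rewrite /spent /= subnDA [e.1 == p]eq_sym. Qed.

Lemma spent_cat f T1 T2 : spent f (T1 ++ T2) =1 spent (spent f T1) T2.
Proof. by move=> p; rewrite /spent /unzip1 map_cat count_cat subnDA. Qed.

Lemma fresh_nil U : fresh U [::].
Proof. by split. Qed.

Lemma fresh_cons U e T :
  fresh U (e :: T) <-> [/\ e.2 \notin U, is_edge e & fresh (e.2 |: U) T].
Proof.
split=> [[/= /andP[eT uT] TU /andP[Ge GT]]|[eU Ge [uT TU GT]]].
  split=> //; first by apply: TU; rewrite inE eqxx.
  split=> // y yT; rewrite !inE negb_or TU ?inE ?yT ?orbT // andbT.
  by apply: contraNneq eT => <-.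
split; rewrite /= ?Ge // ?uT ?andbT; first by apply/negP=> /TU; rewrite !inE eqxx.
move=> y; rewrite inE => /orP[/eqP-> //|/TU].
by rewrite !inE negb_or => /andP[].
Qed.

Lemma fresh_cat U T1 T2 :
  fresh U (T1 ++ T2) <-> fresh U T1 /\ fresh (grown U T1) T2.
Proof.
elim: T1 U => [|e T1 IH] U /=.
  by rewrite grown_nil; split=> [|[]]; [split=> //; exact: fresh_nil|].
rewrite grown_cons; split.
  by case/fresh_cons=> eU Ge /IH[F1 F2]; split=> //; apply/fresh_cons.
by case=> /fresh_cons[eU Ge F1] F2; apply/fresh_cons; split=> //; apply/IH.
Qed.

Lemma fresh_sub U P T : fresh U T -> uniq (unzip2 P) -> {subset P <= T} -> fresh U P.
Proof.
move=> [uT TU GT] uP PT; split=> // [y /mapP[e /PT eT ->]|].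
  by apply: TU; apply: map_f.
by apply/allP=> e /PT; apply: (allP GT).
Qed.

(* A triple ((v, i), y) of T that meets X loses one unit of demand in X but
   takes y from Gamma X, so undoing it never decreases the surplus. *)
Lemma rollback U f T : fresh U T -> extendable (grown U T) (spent f T) -> extendable U f.
Proof.
elim: T U f => [|[[v i] y] T IH] U f.
  by rewrite grown_nil => _; apply: extendable_mono => p; rewrite /spent subn0.
case/fresh_cons => /= yU gy FT ext.
have {ext} : extendable (y |: U) (fun p => f p - (p == (v, i))).
  apply: IH => //; rewrite -(grown_cons _ ((v, i), y)).
  by apply: extendable_mono ext => p; rewrite spent_cons.
move=> ext X cX; have := ext X cX.
have -> : Gamma G X :\: (y |: U) = (Gamma G X :\: U) :\ y.
  by rewrite setDDl [y |: U]setUC.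
rewrite [#|Gamma G X :\: U|](cardsD1 y) inE yU /=.
rewrite -(leq_add2l (y \in Gamma G X)); apply: leq_trans.
have [vX|vX] := boolP ((v, i) \in X).
  rewrite (mem_Gamma vX gy) (big_setD1 _ vX) [in leqRHS](big_setD1 _ vX) /=.
  rewrite eqxx addnA leq_add //; first by rewrite -leq_subLR.
  by rewrite leq_sum // => x; rewrite !inE => /andP[/negPf-> _]; rewrite subn0.
rewrite (leq_trans _ (leq_addl _ _)) // leq_sum // => x xX.
by rewrite (_ : x == _ = false) ?subn0 //; apply: contraNF vX => /eqP <-.
Qed.

(** [T] is reordered so that the kept entries [P] come first; the others are then rolled back. *)
Lemma rollback_sub U f T P : fresh U T -> uniq (unzip2 P) -> {subset P <= T} ->
  extendable (grown U T) (spent f T) -> extendable (grown U P) (spent f P).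
Proof.
move=> FT uP PT ext; set Q := [seq e <- T | e \notin P].
have uT : uniq T by case: FT => /map_uniq.
have permT : perm_eq (P ++ Q) T.
  apply: uniq_perm => // [|e]; first rewrite cat_uniq (map_uniq uP) filter_uniq // andbT.
    by apply/hasPn => e; rewrite mem_filter => /andP[].
  by rewrite mem_cat mem_filter; case: (boolP (e \in P)) => [/PT->|].
have FPQ : fresh U (P ++ Q).
  case: FT => uT' TU GT; split; first by rewrite (perm_uniq (perm_map _ permT)).
    by move=> y; rewrite (perm_mem (perm_map _ permT)); apply: TU.
  by rewrite (perm_all _ permT).
apply: (@rollback _ _ Q); first by case/fresh_cat: FPQ.
have -> : grown (grown U P) Q = grown U T.
  rewrite -grown_cat; apply/setP=> x; rewrite !inE; congr (_ || _).
  by rewrite (perm_mem (perm_map _ permT)).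
apply: extendable_mono ext => p; rewrite -spent_cat /spent.
by rewrite (permP (perm_map _ permT)).
Qed.

Definition grows U f T := fresh U T /\ state (grown U T) (spent f T).

Lemma grows_nil U f : state U f -> grows U f [::].
Proof.
move=> st; split; first exact: fresh_nil.
by rewrite grown_nil; apply: eq_state st => p; rewrite /spent subn0.
Qed.

Lemma grows_cons U f e T : e.2 \notin U -> is_edge e ->
  grows (e.2 |: U) (fun p => f p - (p == e.1)) T -> grows U f (e :: T).
Proof.
move=> eU Ge [FT st]; split; first exact/fresh_cons.
by rewrite grown_cons; apply: eq_state st => p; rewrite spent_cons.
Qed.

Lemma grows_cat U f T1 T2 :
  grows U f T1 -> grows (grown U T1) (spent f T1) T2 -> grows U f (T1 ++ T2).
Proof.
move=> [F1 _] [F2 st]; split; first exact/fresh_cat.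
by rewrite grown_cat; apply: eq_state st => p; rewrite spent_cat.
Qed.

Lemma card_grown U T : fresh U T -> #|grown U T| = #|U| + size T.
Proof.
elim: T U => [|e T IH] U; first by rewrite grown_nil addn0.
by case/fresh_cons=> eU _ /IH; rewrite grown_cons cardsU1 eU => ->; rewrite /= addnS.
Qed.

(** * Growing trees and linking two vertices *)

Section Growth.

Hypotheses (s_gt0 : 0 < s) (joinedG : s_joined s G).

Lemma grow_slots U f (ps : seq (V * 'I_t)) :
  state U f -> {in ps, forall p, p.1 \in U} ->
  (forall p, count_mem p ps <= f p) ->
  #|U| + size ps + s + 2 * s * D <= #|V| ->
  exists2 T, unzip1 T = ps & grows U f T.
Proof.
elim: ps U f => [|[v i] ps IH] U f st psU psf budget.
  by exists [::] => //; apply: grows_nil.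
have [|||y [yU gy sty]] := extend_leaf s_gt0 joinedG st _ (v := v) (i := i).
- by move: budget => /=; lia.
- by apply: (psU (v, i)); rewrite inE eqxx.
- by apply: leq_trans (psf (v, i)); rewrite /= eqxx.
have [||||T defT grT] := IH (y |: U) (fun p => f p - (p == (v, i))) => //.
- by move=> p pps; rewrite !inE psU ?orbT // inE pps orbT.
- move=> p; have := psf p; rewrite /= [_ == p]eq_sym => h.
  by rewrite leq_subRL ?(leq_trans _ h) ?leq_addr.
- by rewrite cardsU1 yU add1n addSnnS.
exists (((v, i), y) :: T); first by rewrite /= defT.
exact: grows_cons.
Qed.

(* The triples ((x_k, i_k), x_(k+1)) of the walk x = x_0, x_1, ... whose later
   vertices are listed in zs and whose edges have the colours listed in cs. *)
Definition trail (x : V) (cs : seq 'I_t) (zs : seq V) : seq (V * 'I_t * V) :=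
  zip (zip (x :: zs) cs) zs.

(** The number of vertices below the [n] roots of a forest whose branching at successive depths is
    [ms]. *)
Fixpoint tree_size (n : nat) (ms : seq nat) :=
  if ms is m :: ms' then n * m + tree_size (n * m) ms' else 0.

(** The tree grows level by level, the children of [L] forming the next [L]. The clause on
    [unzip1 T] keeps the demand at other old vertices intact, so that a second tree can start there;
    the last clause traces each leaf back to its root. *)
Lemma grow_tree (ls : seq ('I_t * nat)) U f (L : seq V) :
  state U f -> uniq L -> {subset L <= U} ->
  {in L, forall x, if ls is (i, m) :: _ then m <= f (x, i) else true} ->
  all (fun l => l.2 <= D) ls ->
  #|U| + tree_size (size L) (unzip2 ls) + s + 2 * s * D <= #|V| ->
  exists T L', [/\ grows U f T,
    forall v i, v \in U -> v \notin L -> (v, i) \notin unzip1 T,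
    size T = tree_size (size L) (unzip2 ls),
    uniq L' /\ size L' = foldl muln (size L) (unzip2 ls) &
    {in L', forall y, exists x zs, [/\ x \in L, size zs = size ls, last x zs = y,
       uniq zs & {subset trail x (unzip1 ls) zs <= T}]}].
Proof.
elim: ls U f L => [|[i m] ls IH] U f L st uL LU Lf lsD budget.
  exists [::], L; split=> //; first exact: grows_nil.
  by move=> y yL; exists y, [::].
pose ps := flatten (nseq m [seq (x, i) | x <- L]).
have sz_ps : size ps = size L * m.
  by rewrite size_flatten /shape map_nseq sumn_nseq size_map.
have in_ps p : p \in ps -> p.1 \in L /\ p.2 = i.
  case/flattenP=> q; rewrite mem_nseq => /andP[_ /eqP->] /mapP[x xL ->] //.
have [|||T1 defT1 gr1] := @grow_slots U f ps st.
- by move=> p /in_ps[/LU].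
- move=> p; have [/in_ps[pL pi]|/count_memPn->//] := boolP (p \in ps).
  rewrite count_flatten map_nseq sumn_nseq; have := Lf _ pL.
  rewrite -pi -surjective_pairing; apply: leq_trans; rewrite -[leqRHS]mul1n leq_mul2r.
  rewrite count_uniq_mem ?leq_b1 ?orbT // map_inj_uniq // => x y [] //.
- by rewrite sz_ps; move: budget => /=; lia.
have [F1 st1] := gr1.
have sz1 : size (unzip2 T1) = size L * m by rewrite size_map -sz_ps -defT1 size_map.
have [|||||T2 [L' [gr2 src2 sz2 [uL' szL'] trail2]]] :=
    IH (grown U T1) (spent f T1) (unzip2 T1) st1.
- by case: F1.
- by move=> y yT; rewrite !inE yT orbT.
(* New vertices have full demand [D], and no slot of [ps] is at one of them, so the next branching
   is affordable. *)
- move=> y yT; have yU : y \notin U by case: F1 => _ + _; apply.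
  case: ls lsD {IH budget} => // [[j m'] ls] /= /and3P[_ m'D _].
  rewrite /spent defT1 (count_memPn _) ?subn0; last first.
    by apply: contra yU => /in_ps[/LU].
  by case: st => _ _ ->.
- by case/andP: lsD.
- rewrite sz1 card_grown //; move: budget.
  by rewrite /= -[size T1](size_map snd) sz1; lia.
exists (T1 ++ T2), L'; split=> //=.
- exact: grows_cat.
- move=> v j vU vL; rewrite /unzip1 map_cat mem_cat negb_or -!/(unzip1 _).
  rewrite defT1 src2 ?inE ?vU //.
    by rewrite andbT; apply: contra vL => /in_ps[].
  by apply/negP; case: F1 => _ h _ /h; rewrite vU.
- by rewrite size_cat sz2 sz1 -[size T1](size_map snd) sz1.
- by rewrite szL' sz1.
move=> y /trail2[x1 [zs [x1T szs last_y uzs sub]]].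
have /mapP[[[x j] x1'] eT /= def_x1] := x1T; subst x1'.
have [xL /= def_j] : x \in L /\ j = i.
  by apply: (in_ps (x, j)); rewrite -defT1; apply: (map_f fst eT).
subst j; exists x, (x1 :: zs); split=> //=; first by rewrite szs.
- rewrite uzs andbT; apply/negP=> x1zs.
  have [_ T2U _] := gr2.1.
  have : x1 \in unzip2 T2.
    have : x1 \in unzip2 (trail x1 (unzip1 ls) zs).
      by rewrite unzip2_zip // size_zip /= size_map szs leq_min leqnSn leqnn.
    by case/mapP=> e /sub eT2 ->; apply: map_f.
  by move/T2U; rewrite !inE x1T orbT.
- by move=> e; rewrite inE mem_cat => /orP[/eqP->|/sub->]; rewrite ?eT ?orbT.
Qed.

Definition flip_edge (e : V * 'I_t * V) : V * 'I_t * V := ((e.2, e.1.2), e.1.1).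

Lemma trail_cat x cs zs cs' zs' : size zs = size cs ->
  trail x (cs ++ cs') (zs ++ zs') = trail x cs zs ++ trail (last x zs) cs' zs'.
Proof. by elim: zs x cs => [|z zs IH] x [|c cs] //= [] /IH <-. Qed.

(** The second tree is grown outwards from the far end, while the finished path runs towards that
    end. *)
Lemma trail_rev x cs zs : size zs = size cs ->
  trail (last x zs) (rev cs) (rev (belast x zs)) = rev (map flip_edge (trail x cs zs)).
Proof.
elim: zs x cs => [|z zs IH] x [|c cs] //= [szs].
rewrite [rev (c :: cs)]rev_cons [rev (x :: _)]rev_cons -!cats1.
rewrite trail_cat ?size_rev ?size_belast // IH // rev_cons -cats1; congr (_ ++ _).
suff -> : last (last z zs) (rev (belast z zs)) = z by [].
rewrite -[LHS]/(last x (last z zs :: rev (belast z zs))) -rev_rcons -lastI.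
by rewrite rev_cons last_rcons.
Qed.

Lemma unzip2_trail x cs zs : size zs = size cs -> unzip2 (trail x cs zs) = zs.
Proof. by move=> szs; rewrite unzip2_zip // size_zip /= szs leq_min leqnSn leqnn. Qed.

Lemma tree_size_nseq1 k n ms :
  tree_size n (nseq k 1 ++ ms) = k * n + tree_size n ms.
Proof. by elim: k => //= k; rewrite muln1 => ->; rewrite mulSn addnA. Qed.

Lemma foldl_mul_nseq1 k n ms : foldl muln n (nseq k 1 ++ ms) = foldl muln n ms.
Proof. by elim: k => //= k; rewrite muln1. Qed.

Lemma foldl_mul_nseq q e n : foldl muln n (nseq e q) = n * q ^ e.
Proof. by elim: e n => [|e IH] n /=; rewrite ?muln1 // IH expnS mulnA. Qed.

(** A geometric sum: for [q >= 2] all levels together are at most twice the last one. *)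
Lemma tree_size_nseq q e n :
  1 < q -> tree_size n (nseq e q) + n.*2 <= (n * q ^ e).*2.
Proof.
move=> q1; elim: e n => [|e IH] n /=; first by rewrite muln1.
have nq : n.*2 <= n * q by rewrite -muln2 leq_mul2l q1 orbT.
by have := IH (n * q); rewrite expnS mulnA; lia.
Qed.

(** Minimality of the exponent limits the overshoot to one factor [q], so a tree with at least [s]
    leaves has at most [(D - 1) * s] of them. *)
Lemma exp_up_log_bound q n : 1 < q -> 0 < n -> n <= q ^ up_log q n <= q * n.
Proof.
move=> q1 n0; rewrite up_logP //=.
have [n1|] := ltnP 1 n; last by case: n n0 => [|[|n]] // _ _; rewrite up_log1 muln1 ltnW.
have := up_log_bounds q1 n1; have := up_log_gt0 q n; rewrite q1 n1 /=.
by case: up_log => // k _ /andP[/= /ltnW kn _]; rewrite expnS leq_mul2l kn orbT.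
Qed.

(** For a path [Q], the first term counts the edges of colour [p.2] leaving [p.1], the second those
    arriving. *)
Definition in_use (Q : seq (V * 'I_t * V)) (p : V * 'I_t) :=
  count_mem p (unzip1 Q) + count_mem p (unzip1 (map flip_edge Q)).

(* Each end grows a (D-1)-ary tree with at least s leaves; joinedness links two
   leaves, and everything off the resulting path is rolled back. *)
Lemma connect_pair U f va vb (ca cb : seq 'I_t) cm : 3 <= D -> graph_family G ->
  state U f -> va \in U -> vb \in U -> va != vb ->
  0 < f (va, head cm ca) -> 0 < f (vb, head cm cb) ->
  up_log (D - 1) s < size ca -> size cb = (up_log (D - 1) s).+1 ->
  #|U| + size ca + size cb + 6 * s * D <= #|V| ->
  exists xs, let Q := trail va (ca ++ cm :: rev cb) (rcons xs vb) in
    [/\ size xs = size ca + size cb, uniq xs, {in xs, forall x, x \notin U},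
        all is_edge Q & extendable (U :|: [set x in xs]) (fun p => f p - in_use Q p)].
Proof.
set e := up_log _ _ => D3 famG st vaU vbU vab fa fb sza szb budget.
have q1 : 1 < D - 1 by lia.
have /andP[se eq] := exp_up_log_bound q1 s_gt0; rewrite -/e in se eq.
have := tree_size_nseq e 1 q1; rewrite mul1n.
set tsz := tree_size 1 _ => tsz_le.
have Ds : (D - 1) * s + s = s * D by rewrite -mulSnr subn1 prednK 1?mulnC // ltnW // ltnW.
(* Two such trees and the reserve [s + 2 * s * D] of the growth lemmas thus fit into [6 * s * D]. *)
have tszB : tsz + s + 1 <= 2 * s * D by rewrite -mulnA -Ds; lia.
(* Each tree starts with a bare path, so its root needs only one unit of demand; at [va] this path
   also absorbs the surplus length. *)
pose msa := nseq (size ca - e) 1 ++ nseq e (D - 1).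
pose msb := nseq 1 1 ++ nseq e (D - 1).
have sz_msa : size ca = size msa by rewrite size_cat !size_nseq subnK // ltnW.
have sz_msb : size cb = size msb by rewrite size_cat !size_nseq szb.
have all_leD k (cs : seq 'I_t) :
    all (fun l => l.2 <= D) (zip cs (nseq k 1 ++ nseq e (D - 1))).
  apply/allP=> -[c m] /(map_f snd) /= mz.
  have : m \in nseq k 1 ++ nseq e (D - 1).
    elim: cs (nseq k 1 ++ _) mz => [|? ? IH] [|? ?] //=.
    by rewrite !inE => /orP[->//|/IH->]; rewrite orbT.
  by rewrite mem_cat !mem_nseq => /orP[]/andP[_ /eqP->]; lia.
have [|||||Ta [La [gra srca sza' [uLa szLa] traila]]] :=
    @grow_tree (zip ca msa) U f [:: va] st.
- by [].
- by move=> x; rewrite inE => /eqP->.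
- move=> x; rewrite inE => /eqP->; rewrite /msa; case: (ca) sza fa => [|c ca'] //= sz fc.
  by case: (_ - _) (subn_gt0 e (size ca').+1) => //; rewrite sz.
- exact: all_leD.
- rewrite unzip2_zip -?sz_msa // /msa tree_size_nseq1 -/tsz /=.
  by apply: leq_trans budget; rewrite -!addnA leq_add2l; lia.
rewrite unzip2_zip -?sz_msa // tree_size_nseq1 muln1 -/tsz /= in sza'.
rewrite unzip2_zip -?sz_msa // foldl_mul_nseq1 foldl_mul_nseq mul1n /= in szLa.
have [Fa sta] := gra.
have [|||||Tb [Lb [grb srcb szb' [uLb szLb] trailb]]] :=
    @grow_tree (zip cb msb) (grown U Ta) (spent f Ta) [:: vb] sta.
- by [].
- by move=> x; rewrite !inE => /eqP->; rewrite vbU.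
(* [vb] is an old vertex other than [va], so the first tree left its demand untouched. *)
- move=> x; rewrite inE => /eqP->; case: (cb) szb fb => [|c cb'] //= sz fc.
  by rewrite /spent (count_memPn _) ?subn0 // srca // inE eq_sym.
- exact: all_leD.
- rewrite card_grown // sza' unzip2_zip -?sz_msb // /msb tree_size_nseq1 -/tsz /=.
  by apply: leq_trans budget; rewrite -!addnA leq_add2l; lia.
rewrite unzip2_zip -?sz_msb // foldl_mul_nseq1 foldl_mul_nseq mul1n /= in szLb.
have [Fb [extb _ _]] := grb.
have [v [c' [y [vX yY gvy]]]] :
    exists v i y, [/\ (v, i) \in [set x in [seq (x, cm) | x <- La]],
      y \in [set x in Lb] & G i v y].
  apply: joinedG; rewrite cardsE; last by move/card_uniqP: uLb => ->; rewrite szLb.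
  have /card_uniqP -> : uniq [seq (x, cm) | x <- La].
    by rewrite map_inj_uniq // => x x' [].
  by rewrite size_map szLa.
move: vX yY; rewrite !inE => /mapP[v' vLa [? ?]] yLb; subst v' c'.
have [va' [za [+ sz_za last_za uza suba]]] := traila _ vLa.
rewrite inE => /eqP ?; subst va'.
have [vb' [zb [+ sz_zb last_zb uzb subb]]] := trailb _ yLb.
rewrite inE => /eqP ?; subst vb'.
rewrite size_zip -sz_msa minnn in sz_za; rewrite size_zip -sz_msb minnn in sz_zb.
rewrite unzip1_zip -?sz_msa // in suba; rewrite unzip1_zip -?sz_msb // in subb.
have [Fab [extab _ _]] := grows_cat gra grb.
have szt : size (za ++ rev zb) = size ca + size cb.
  by rewrite size_cat size_rev sz_za sz_zb.
have uz2 : unzip2 (trail va ca za ++ trail vb cb zb) = za ++ zb.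
  by rewrite /unzip2 map_cat -!/(unzip2 _) !unzip2_trail.
have subP : {subset trail va ca za ++ trail vb cb zb <= Ta ++ Tb}.
  by move=> d; rewrite !mem_cat => /orP[/suba|/subb]->; rewrite ?orbT.
have uz : uniq (za ++ zb).
  rewrite cat_uniq uza uzb andbT; apply/hasPn => x xzb.
  have /mapP[d /subb db ->] : x \in unzip2 (trail vb cb zb) by rewrite unzip2_trail.
  have : d.2 \notin grown U Ta by case: Fb => _ + _; apply; apply: map_f.
  rewrite !inE negb_or => /andP[_]; apply: contra => dza.
  have /mapP[d' /suba da' ->] : d.2 \in unzip2 (trail va ca za) by rewrite unzip2_trail.
  exact: map_f.
have uP : uniq (unzip2 (trail va ca za ++ trail vb cb zb)) by rewrite uz2.
have [_ PU GP] := fresh_sub Fab uP subP.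
have extP := rollback_sub Fab uP subP extab.
exists (za ++ rev zb).
set Q := trail _ _ _.
have defQ : Q = trail va ca za ++ ((v, cm), y) :: rev (map flip_edge (trail vb cb zb)).
  rewrite /Q -cats1 -catA trail_cat // last_za; congr (_ ++ _).
  by rewrite cats1 -rev_cons [vb :: zb]lastI rev_rcons -trail_rev // last_zb.
split=> //.
- by rewrite cat_uniq rev_uniq has_rev -cat_uniq.
- by move=> x xz; apply: PU; rewrite uz2; move: xz; rewrite !mem_cat mem_rev.
- rewrite defQ all_cat /= all_rev all_map.
  move: GP; rewrite all_cat => /andP[-> /allP GPb].
  rewrite /= /is_edge /= gvy /=; apply/allP=> d /GPb; rewrite /is_edge /=.
  by case: (famG d.1.2) => ->.
have -> : U :|: [set x in za ++ rev zb] = grown U (trail va ca za ++ trail vb cb zb).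
  by apply/setP=> x; rewrite !inE uz2 !mem_cat mem_rev.
(* Tree entries are charged at the parent end only. Charging the child ends and the link too only
   lowers demand. *)
apply: extendable_mono extP => p; rewrite /spent leq_sub2l // /in_use defQ.
rewrite /unzip1 !map_cat !count_cat /= !map_rev !count_rev.
have -> : map flip_edge (map flip_edge (trail vb cb zb)) = trail vb cb zb.
  by rewrite -map_comp -[RHS]map_id; apply: eq_map => -[[? ?] ?].
by apply: leq_add; [exact: leq_addr|rewrite addnA leq_addl].
Qed.

End Growth.

End Extendability.

(** * Consecutive pairs along a sequence *)

Section Consecutive.

Variable W : eqType.
Implicit Types (a b x y : W) (m q : seq W).

Definition steps a q : seq (W * W) := zip (a :: q) q.

Lemma unzip1_steps a m b : unzip1 (steps a (rcons m b)) = a :: m.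
Proof. by elim: m a => //= x m IH a; rewrite IH. Qed.

Lemma unzip2_steps a q : unzip2 (steps a q) = q.
Proof. by rewrite unzip2_zip //= leqW. Qed.

Lemma steps_rcons a m b : steps a (rcons m b) = rcons (steps a m) (last a m, b).
Proof. by elim: m a => //= x m IH a; rewrite /steps /= -IH. Qed.

Lemma mem_steps a q x y : (x, y) \in steps a q -> x \in a :: q /\ y \in q.
Proof.
elim: q a => //= z q IH a; rewrite !inE => /orP[/eqP[-> ->]|/IH[]].
  by rewrite !eqxx.
by rewrite inE => -> ->; rewrite !orbT.
Qed.

Lemma steps_path (e : rel W) a q x y : path e a q -> (x, y) \in steps a q -> e x y.
Proof.
by elim: q a => //= z q IH a /andP[az /IH zq]; rewrite inE => /orP[/eqP[-> ->]|/zq].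
Qed.

(** This makes steps directed: positions grow by one along a step, so none occurs in reverse as
    well. *)
Lemma index_steps a q x y : uniq (a :: q) -> (x, y) \in steps a q ->
  index y (a :: q) = (index x (a :: q)).+1.
Proof.
elim: q a => // z q IH a /andP[az uq].
rewrite inE => /orP[/eqP[-> ->]|xy].
  by rewrite /= eqxx; case: eqP az => [->|_]; rewrite ?inE ?eqxx.
have [xq yq] := mem_steps xy; have {}yq : y \in z :: q by rewrite inE yq orbT.
have /negPf ax : a != x by apply: contraNneq az => ->.
have /negPf ay : a != y by apply: contraNneq az => ->.
by rewrite /= ax ay; congr _.+1; apply: IH.
Qed.

Lemma steps_asym a q x y :
  uniq (a :: q) -> (x, y) \in steps a q -> (y, x) \notin steps a q.
Proof.
move=> uq xy; apply/negP=> /(index_steps uq); rewrite (index_steps uq xy); lia.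
Qed.

End Consecutive.

(** * Embedding the coloured graph piece by piece *)

Section Embedding.

Variables (s t D : nat) (V W : finType) (G : 'I_t -> rel V).
Variable c : W -> W -> option 'I_t.
Hypotheses (s_gt0 : 0 < s) (D_ge3 : 3 <= D) (i0 : 'I_t).
Hypotheses (famG : graph_family G) (joinedG : s_joined s G).
Hypotheses (colc : colgraph [set: W] c) (degc : mon_deg_le [set: W] c D).
Hypothesis card_le : #|W| + 6 * s * D <= #|V|.

Implicit Types (S : {set W}) (E : rel W) (phi : W -> V).

(** [E] holds the edges embedded so far; their colours are read from [c]. *)
Definition edeg E (i : 'I_t) (h : W) := #|[set y | E h y && (c h y == Some i)]|.

Definition demand S E phi (p : V * 'I_t) :=
  D - \sum_(h in S | phi h == p.1) edeg E p.2 h.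

Definition partial_embedding S E phi :=
  [/\ {in S &, injective phi}, forall x y, E x y -> x \in S /\ y \in S,
      forall x y i, E x y -> c x y = Some i -> G i (phi x) (phi y) &
      extendable s G (phi @: S) (demand S E phi)].

Lemma demand_in S E phi h i : {in S &, injective phi} -> h \in S ->
  demand S E phi (phi h, i) = D - edeg E i h.
Proof.
move=> injphi hS; rewrite /demand (big_pred1 h) // => x /=.
by apply/andP/eqP=> [[xS /eqP/injphi->]|->].
Qed.

Lemma demand_out S E phi v i : v \notin phi @: S -> demand S E phi (v, i) = D.
Proof.
move=> vS; rewrite /demand big_pred0 ?subn0 // => h; apply/andP=> -[hS /eqP /= hv].
by case/negP: vS; rewrite -hv imset_f.
Qed.

Lemma demand_state S E phi :
  partial_embedding S E phi -> state s D G (phi @: S) (demand S E phi).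
Proof.
by case=> _ _ _ ext; split=> // [p|v i]; [exact: leq_subr|exact: demand_out].
Qed.

Lemma edeg_le E i h : edeg E i h <= D.
Proof.
apply: leq_trans (degc i (in_setT h)); apply: subset_leq_card.
by apply/subsetP=> y; rewrite !inE => /andP[].
Qed.

Lemma eq_partial_embedding S E E' phi :
  E =2 E' -> partial_embedding S E phi -> partial_embedding S E' phi.
Proof.
move=> eqE [injphi ES Ephi ext]; split=> // [x y|x y i|]; rewrite -?eqE //.
- exact: ES.
- exact: Ephi.
apply: extendable_mono ext => p; rewrite leq_sub2l // leq_sum // => h _.
by rewrite subset_leq_card //; apply/subsetP=> y; rewrite !inE eqE.
Qed.

Lemma card_image_le S phi : #|phi @: S| <= #|W|.
Proof. by rewrite (leq_trans (leq_imset_card _ _)) // max_card. Qed.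

Lemma embed_vertex S E phi x : partial_embedding S E phi ->
  exists2 phi', {in S, phi' =1 phi} & partial_embedding (x |: S) E phi'.
Proof.
move=> PE; have [xS|xS] := boolP (x \in S).
  by exists phi => //; rewrite (setUidPr _) // sub1set.
have [injphi ES Ephi _] := PE.
have [|y yU [ext _ _]] := extend_isolated s_gt0 joinedG (demand_state PE).
  by have := card_image_le S phi; nia.
pose phi' h := if h == x then y else phi h.
have phi'S : {in S, phi' =1 phi}.
  by move=> h hS; rewrite /phi' (_ : h == x = false) //; apply: contraNF xS => /eqP<-.
have phi'x : phi' x = y by rewrite /phi' eqxx.
have yS h : h \in S -> phi h <> y by move=> hS hy; case/negP: yU; rewrite -hy imset_f.
have im : phi' @: (x |: S) = y |: phi @: S.
  by rewrite imsetU1 phi'x; congr (_ |: _); apply: eq_in_imset.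
have inj' : {in x |: S &, injective phi'}.
  move=> h k; rewrite !inE => /orP[/eqP->|hS] /orP[/eqP->|kS] //;
    rewrite ?phi'x ?phi'S // => hk; [|by case: (yS _ hS)|exact: injphi].
  by case: (yS _ kS).
exists phi' => //; split=> //.
- by move=> h k /ES[hS kS]; rewrite !inE hS kS !orbT.
- by move=> h k i Ehk; have [hS kS] := ES _ _ Ehk; rewrite !phi'S //; apply: Ephi.
rewrite im; apply: extendable_mono ext => -[v i].
rewrite /demand leq_sub2l // big_mkcond [leqRHS]big_mkcond leq_sum //= => h _.
have [hS|//] := boolP (h \in S); rewrite !inE hS orbT phi'S //.
Qed.

Lemma embed_vertices S E phi (l : seq W) : partial_embedding S E phi ->
  exists2 phi', {in S, phi' =1 phi} & partial_embedding (S :|: [set x in l]) E phi'.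
Proof.
elim: l S phi => [|x l IH] S phi PE.
  exists phi => //; suff -> : [set x in [::]] = set0 :> {set W} by rewrite setU0.
  by apply/setP=> y; rewrite !inE.
have [phi1 phi1S /IH[phi2 phi2S PE2]] := embed_vertex x PE.
exists phi2 => [h hS|]; first by rewrite phi2S ?phi1S // inE hS orbT.
by congr partial_embedding: PE2; apply/setP=> y; rewrite !inE orbCA orbA.
Qed.

(** The edge [ax] is not embedded yet, as [x] is outside [S]; so the embedded colour-[i] edges at
    [a] are fewer than its degree, which is at most [D]. *)
Lemma free_slot S E phi a x i : partial_embedding S E phi ->
  a \in S -> x \notin S -> c a x = Some i -> 0 < demand S E phi (phi a, i).
Proof.
move=> [injphi ES _ _] aS xS ax; rewrite demand_in // subn_gt0.
apply: leq_trans (degc i (in_setT a)); apply: proper_card.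
apply/properP; split; first by apply/subsetP=> y; rewrite !inE => /andP[].
by exists x; rewrite !inE ?ax ?eqxx // andbT; apply: contra xS => /ES[].
Qed.

Definition colour x y := odflt i0 (c x y).

Lemma colourE x y i : c x y = Some i -> colour x y = i.
Proof. by rewrite /colour => ->. Qed.

Lemma colour_adj x y : adj c x y -> c x y = Some (colour x y).
Proof. by rewrite /adj /colour; case: (c x y). Qed.

Definition colours a q := [seq colour d.1 d.2 | d <- steps a q].

Lemma size_colours a q : size (colours a q) = size q.
Proof. by rewrite size_map size_zip /= minnC /minn ltnS leqnn. Qed.

Lemma trail_map (phi : W -> V) a q :
  trail (phi a) (colours a q) (map phi q)
    = [seq ((phi d.1, colour d.1 d.2), phi d.2) | d <- steps a q].
Proof. by elim: q a => //= x q IH a; rewrite -IH. Qed.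

(** [A] collects the steps leaving [h], [B] those entering it. The path repeats no vertex, so no
    step occurs in both directions and the two sets are disjoint. *)
Lemma in_use_le (phi : W -> V) a m b S h i :
  {in S &, injective phi} -> {subset a :: rcons m b <= S} -> h \in S ->
  path (adj c) a (rcons m b) -> uniq (a :: rcons m b) ->
  in_use (trail (phi a) (colours a (rcons m b)) (map phi (rcons m b))) (phi h, i)
    <= edeg (pedge (a :: rcons m b)) i h.
Proof.
move=> injphi pS hS path_p up; have [csym _ _] := colc.
set q := rcons m b; pose A := [set y | ((h, y) \in steps a q) && (c h y == Some i)].
pose B := [set y | ((y, h) \in steps a q) && (c h y == Some i)].
have stS x y : (x, y) \in steps a q -> x \in S /\ y \in S.
  by case/mem_steps=> xp yp; split; apply: pS; rewrite // inE yp orbT.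
have eqh x : x \in S -> phi x = phi h -> x = h by move=> xS; apply: injphi.
have ust1 : uniq (unzip1 (steps a q)).
  by move: up; rewrite unzip1_steps -rcons_cons rcons_uniq => /andP[].
have ust2 : uniq (unzip2 (steps a q)) by rewrite unzip2_steps; case/andP: up.
have ust : uniq (steps a q) by apply: map_uniq ust1.
have -> : edeg (pedge (a :: q)) i h = #|A :|: B|.
  by apply: eq_card => y; rewrite !inE /pedge -andb_orl.
have -> : #|A :|: B| = #|A| + #|B|.
  rewrite -cardsUI (_ : A :&: B = set0) ?cards0 ?addn0 //.
  apply/setP=> y; rewrite !inE; apply/negP=> /andP[/andP[hy _] /andP[yh _]].
  by have := steps_asym up hy; rewrite yh.
rewrite /in_use trail_map /unzip1 -!map_comp !count_map; apply: leq_add.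
- rewrite -size_filter -(size_map snd) cardE uniq_leq_size //.
    rewrite map_inj_in_uniq ?filter_uniq // => -[x y] [x' y'] /=.
    rewrite !mem_filter /= => /andP[/eqP[ex _] xy] /andP[/eqP[ex' _] xy'] ->.
    have -> : x = h by apply: eqh ex; case: (stS _ _ xy).
    by have -> : x' = h by apply: eqh ex'; case: (stS _ _ xy').
  move=> y /mapP[[x y'] /= + ->]; rewrite mem_filter /= => /andP[/eqP[hx col] xy].
  have {}hx : x = h by apply: eqh hx; case: (stS _ _ xy).
  by rewrite mem_enum inE -hx xy (colour_adj (steps_path path_p xy)) col eqxx.
rewrite -size_filter -(size_map fst) cardE uniq_leq_size //.
  rewrite map_inj_in_uniq ?filter_uniq // => -[x y] [x' y'] /=.
  rewrite !mem_filter /= => /andP[/eqP[ex _] xy] /andP[/eqP[ex' _] xy'] ->.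
    have -> : y = h by apply: eqh ex; case: (stS _ _ xy).
    by have -> : y' = h by apply: eqh ex'; case: (stS _ _ xy').
move=> y /mapP[[y' x] /= + ->]; rewrite mem_filter /= => /andP[/eqP[hx col] xy].
have {}hx : x = h by apply: eqh hx; case: (stS _ _ xy).
by rewrite mem_enum inE -hx xy csym (colour_adj (steps_path path_p xy)) col eqxx.
Qed.

Lemma connect_seq U f va vb (cs : seq 'I_t) :
  state s D G U f -> va \in U -> vb \in U -> va != vb ->
  0 < f (va, head i0 cs) -> 0 < f (vb, last i0 cs) -> ell s D <= size cs ->
  #|U| + (size cs).-1 + 6 * s * D <= #|V| ->
  exists xs, let Q := trail va cs (rcons xs vb) in
    [/\ size xs = (size cs).-1, uniq xs, {in xs, forall x, x \notin U},
        all (is_edge G) Q &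
        extendable s G (U :|: [set x in xs]) (fun p => f p - in_use Q p)].
Proof.
rewrite /ell; set e := up_log _ _ => st vaU vbU vab fa fb ell_le budget.
(* The tree at [vb] takes [e + 1] colours and the link one; the other [n] go to the tree at [va]. As
   [ell s D] is [2 * e + 3], [n] exceeds [e]. *)
pose n := size cs - e.+2; pose ca := take n cs; pose cm := nth i0 cs n.
pose cb := rev (drop n.+1 cs).
have n_lt : n < size cs by rewrite /n; lia.
have defcs : cs = ca ++ cm :: rev cb by rewrite revK -drop_nth // cat_take_drop.
have sza : size ca = n by rewrite size_take n_lt.
have szb : size cb = e.+1 by rewrite size_rev size_drop /n; lia.
have := connect_pair s_gt0 joinedG (ca := ca) (cb := cb) (cm := cm) D_ge3 famG st
  vaU vbU vab.
rewrite -defcs sza szb (_ : n + e.+1 = (size cs).-1); last by rewrite /n; lia.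
apply=> //.
- by move: fa; rewrite {1}defcs; case: (ca) sza => //=; rewrite /n; lia.
- move: fb; rewrite {1}defcs last_cat /=; case: (cb) szb => //= j cb' _.
  by rewrite rev_cons last_rcons.
- by rewrite /n -/e; lia.
by rewrite -(addnA #|U|) (_ : n + e.+1 = (size cs).-1) // /n; lia.
Qed.

Lemma embed_path S E phi a m b :
  partial_embedding S E phi -> a \in S -> b \in S ->
  {in m, forall x, x \notin S} -> path (adj c) a (rcons m b) -> uniq (a :: rcons m b) ->
  ell s D <= (size m).+1 ->
  exists2 phi', {in S, phi' =1 phi} &
    partial_embedding (S :|: [set x in m])
      (fun x y => E x y || pedge (a :: rcons m b) x y) phi'.
Proof.
move=> PE aS bS mS path_p up ell_le; have [injphi ES Ephi _] := PE.
have [csym _ _] := colc.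
have ab : a != b by move: up; rewrite /= mem_rcons inE negb_or => /andP[/andP[]].
have um : uniq m by move: up; rewrite /= rcons_uniq => /and3P[].
have m_gt0 : 0 < size m by move: ell_le; rewrite /ell; lia.
have imU h : h \in S -> phi h \in phi @: S by apply: imset_f.
(* The internal vertices are new, so [S] and the path fit into [W] and the budget follows from
   [card_le]. *)
have cardSm : #|phi @: S| + size m <= #|W|.
  have -> : #|phi @: S| = #|S| by apply: card_in_imset.
  have -> : size m = #|[set x in m]| by rewrite cardsE; apply/esym/card_uniqP.
  rewrite -[X in X + _]addn0 -[leqRHS]cardsT.
  rewrite addn0 -cardsUI (_ : S :&: _ = set0) ?cards0 ?addn0 ?subset_leq_card ?subsetT //.
  by apply/setP=> x; rewrite !inE; apply/negP=> /andP[xS /mS]; rewrite xS.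
have [|||||||xs [szxs uxs xsU edges ext]] := @connect_seq (phi @: S) (demand S E phi)
    (phi a) (phi b) (colours a (rcons m b)) (demand_state PE).
- exact: imU.
- exact: imU.
- by apply: contraNneq ab => /injphi->.
(* Both ends have a free slot, since the first and last edges lead to internal vertices, none of
   them embedded yet. *)
- case: (m) m_gt0 mS path_p => //= x m' _ mS /andP[/colour_adj ax _].
  by apply: (free_slot PE aS _ ax); apply: mS; rewrite inE eqxx.
- rewrite /colours steps_rcons map_rcons last_rcons /=.
  have lm : last a m \in m by case: (m) m_gt0 => //= x m' _; apply: mem_last.
  have zb : adj c (last a m) b by move: path_p; rewrite rcons_path => /andP[].
  by apply: (free_slot PE bS (mS _ lm)); rewrite csym; apply: colour_adj.
- by rewrite size_colours size_rcons.
- by rewrite size_colours size_rcons /=; apply: leq_trans card_le; rewrite leq_add2r.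
rewrite size_colours size_rcons /= in szxs.
pose phi' h := if h \in S then phi h else nth (phi a) xs (index h m).
have phi'S : {in S, phi' =1 phi} by move=> h hS; rewrite /phi' hS.
have phi'm : map phi' m = xs.
  apply: (@eq_from_nth _ (phi a)); rewrite size_map // => k km.
  rewrite (nth_map a) // /phi' (negPf (mS _ (mem_nth a km))).
  by rewrite index_uniq.
have map_p : map phi' (rcons m b) = rcons xs (phi b) by rewrite map_rcons phi'm phi'S.
have phi'xs x : x \in m -> phi' x \in xs by move=> xm; rewrite -phi'm map_f.
have inj' : {in S :|: [set x in m] &, injective phi'}.
  have SM x y : x \in S -> y \in m -> phi' x <> phi' y.
    by move=> xS /phi'xs/xsU /negP yU xy; apply: yU; rewrite -xy phi'S ?imU.
  move=> x y; rewrite !inE => /orP[xS|xm] /orP[yS|ym] xy.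
  - by apply: injphi => //; rewrite -!phi'S.
  - by case: (SM _ _ xS ym).
  - by case: (SM _ _ yS xm).
  apply: (index_inj a xm ym); apply/eqP.
  rewrite -(nth_uniq (phi a) _ _ uxs) ?szxs ?index_mem //.
  by move: xy; rewrite /phi' (negPf (mS _ xm)) (negPf (mS _ ym)) => ->.
have im : phi' @: (S :|: [set x in m]) = phi @: S :|: [set x in xs].
  rewrite imsetU; congr (_ :|: _); first exact: eq_in_imset.
  apply/setP=> v; rewrite inE -phi'm; apply/imsetP/mapP => -[x].
    by rewrite inE => xm ->; exists x.
  by move=> xm ->; exists x => //; rewrite inE.
have pS : {subset a :: rcons m b <= S :|: [set x in m]}.
  move=> x; rewrite !inE mem_rcons inE.
  by move=> /or3P[/eqP->|/eqP->|->]; rewrite ?aS ?bS ?orbT.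
(* As [m] is nonempty and avoids [S], every step has an end outside [S]; hence the path shares no
   edge with [E] and degrees add up. *)
have stepsS x y : (x, y) \in steps a (rcons m b) -> x \in S -> y \in S -> false.
  rewrite steps_rcons mem_rcons inE => /orP[/eqP[-> _]|/mem_steps[_ ym] _ yS].
    by case: (m) m_gt0 mS => //= z m' _ mS lS; have := mS _ (mem_last z m'); rewrite lS.
  by have := mS _ ym; rewrite yS.
have trailE := trail_map phi' a (rcons m b); rewrite map_p phi'S // in trailE.
have stepsG x y i : (x, y) \in steps a (rcons m b) -> c x y = Some i ->
    G i (phi' x) (phi' y).
  move=> xy cxy; rewrite trailE in edges; rewrite -(colourE cxy).
  by move/allP: edges => /(_ _ (map_f _ xy)).
exists phi' => //; split=> //.
- move=> x y /orP[/ES[xS yS]|]; first by rewrite !inE xS yS.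
  by case/orP=> /mem_steps[xp yp]; split; apply: pS; rewrite // inE ?yp ?orbT.
- move=> x y i /orP[Exy|/orP[xy|yx]] cxy.
  + by have [xS yS] := ES _ _ Exy; rewrite !phi'S //; apply: Ephi.
  + exact: stepsG.
  + by rewrite (famG i).1; apply: stepsG => //; rewrite csym.
rewrite im; apply: extendable_mono ext => -[v i].
set Q := trail _ _ _.
have [/imsetP[h hS ->]|vU] := boolP (v \in phi' @: (S :|: [set x in m])); last first.
  rewrite [demand S E phi _]demand_out; last by apply: contra vU; rewrite im inE => ->.
  have Q1 : (v, i) \notin unzip1 Q.
    rewrite /Q trailE; apply: contra vU => /mapP[d /mapP[[x y] xy ->] [-> _]].
    by apply: imset_f; apply: pS; case/mem_steps: xy.
  have Q2 : (v, i) \notin unzip1 (map (@flip_edge t V) Q).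
    rewrite /Q trailE.
    apply: contra vU => /mapP[d /mapP[d' /mapP[[x y] xy ->] ->] [-> _]].
    apply: imset_f; apply: pS; case/mem_steps: xy => _.
    by rewrite inE => ->; rewrite orbT.
  by rewrite /in_use (count_memPn Q1) (count_memPn Q2) subn0; apply: leq_subr.
rewrite demand_in //.
(* An internal vertex goes to a point outside the old image, where the demand was [D], and it has no
   edge in [E]; so the formula covers it too. *)
have -> : demand S E phi (phi' h, i) = D - edeg E i h.
  have [hS'|hS'] := boolP (h \in S); first by rewrite phi'S // demand_in.
  rewrite demand_out; last first.
    by apply: xsU; apply: phi'xs; move: hS; rewrite !inE (negPf hS').
  rewrite /edeg (_ : [set _ | _] = set0) ?cards0 ?subn0 //.
  by apply/setP=> y; rewrite !inE; apply/negP=> /andP[/ES[]]; rewrite (negPf hS').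
have := in_use_le i inj' pS hS path_p up; rewrite map_p phi'S // -/Q => useQ.
rewrite -subnDA leq_sub2l // (leq_trans (leq_add (leqnn _) useQ)) //.
rewrite /edeg -cardsUI (_ : _ :&: _ = set0) ?cards0 ?addn0.
  by apply: subset_leq_card; apply/subsetP=> y; rewrite !inE -andb_orl.
apply/setP=> y; rewrite !inE; apply/negP=> /andP[/andP[/ES[h1 y1] _] /andP[/orP[] st _]].
  by have := stepsS _ _ st h1 y1.
by have := stepsS _ _ st y1 h1.
Qed.

(** * Embedding all paths in turn *)

Definition covered V0 (Ps : seq (seq W)) k := [set v | prior V0 Ps k v].

Definition used_edges (c0 : W -> W -> option 'I_t) (Ps : seq (seq W)) k : rel W :=
  fun x y => adj c0 x y || has (fun j => pedge (nth [::] Ps j) x y) (iota 0 k).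

Lemma embed_paths V0 c0 Ps phi : path_constructible_with V0 c0 c Ps ->
  (forall j, j < size Ps -> ell s D <= plength (nth [::] Ps j)) ->
  partial_embedding V0 (adj c0) phi ->
  exists2 phi', {in V0, phi' =1 phi} &
    partial_embedding (covered V0 Ps (size Ps)) (used_edges c0 Ps (size Ps)) phi'.
Proof.
case=> paths _ _ internals _ lengths PE.
suff : forall k, k <= size Ps -> exists2 phi', {in V0, phi' =1 phi} &
    partial_embedding (covered V0 Ps k) (used_edges c0 Ps k) phi' by apply.
elim=> [_|k IH kPs].
  exists phi => //; rewrite (_ : covered V0 Ps 0 = V0).
    by apply: eq_partial_embedding PE => x y; rewrite /used_edges orbF.
  by apply/setP=> x; rewrite inE /prior orbF.
have [phi1 phi1V PE1] := IH (ltnW kPs).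
have := paths k kPs; have := lengths k kPs; have := internals k ^~ kPs.
case def_p : (nth [::] Ps k) => [//|a q]; rewrite /is_path /plength.
(* A single vertex is a path of length 0, shorter than [ell s D], so the path has two ends [a] and
   [b]. *)
case/lastP: q def_p => [|m b] def_p; first by rewrite /ell addn3.
rewrite [size _]/= size_rcons [internal _]/= belast_rcons [behead _]/=.
move=> new ell_le /andP[path_p up].
(* An end not covered yet is first placed as an isolated vertex. *)
have [phi2 phi2S PE2] := embed_vertices [:: a; b] PE1.
have [||||||phi3 phi3S PE3] := embed_path PE2 (a := a) (b := b) (m := m).
- by rewrite !inE eqxx orbT.
- by rewrite !inE eqxx !orbT.
- move=> x xm; rewrite !inE negb_or new //=.
  move: up; rewrite /= mem_rcons inE negb_or rcons_uniq => /andP[/andP[_ am] /andP[bm _]].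
  by apply/norP; split; apply: contraTneq xm => ->.
- exact: path_p.
- exact: up.
- exact: ell_le.
exists phi3.
  move=> x xV; have xC : x \in covered V0 Ps k by rewrite inE /prior xV.
  by rewrite phi3S ?phi2S ?phi1V // inE xC.
have iotaS : iota 0 k.+1 = rcons (iota 0 k) k by rewrite -addn1 iotaD -cats1.
have -> : covered V0 Ps k.+1 = covered V0 Ps k :|: [set x in [:: a; b]] :|: [set x in m].
  apply/setP=> x; rewrite !inE /prior iotaS has_rcons def_p inE mem_rcons inE.
  by rewrite [_ || has _ _]orbC !orbA [(x \in V0) || _]orbC -!orbA; do !bool_congr.
apply: eq_partial_embedding PE3 => x y.
by rewrite /used_edges iotaS has_rcons def_p orbCA orbC.
Qed.

(** * Goodness versus extendability *)

Lemma rooted_setT (c' : W -> W -> option 'I_t) : rooted [set: W] c' [set: W].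
Proof.
have no_edge x y : redge [set: W] c' x y = false by rewrite /redge !inE andbF.
split=> [||v _]; first exact: subsetT.
  by case=> [|x [|y l]] // _ _; apply/negP=> /= /andP[]; rewrite no_edge.
exists v; split=> [|r [_ /connectP[[|z l] /= vl ->]]] //; last by rewrite no_edge in vl.
Qed.

(** [demand] subtracts in [nat], [Rval] in the integers; they agree since no degree exceeds [D]. *)
Lemma sum_demand S E (c' : W -> W -> option 'I_t) phi (X : {set V * 'I_t}) :
  {in S &, injective phi} -> (forall i h, edeg E i h = cdeg c' i h) ->
  (\sum_(x in X) (D%:Z - (degphi S c' phi x.2 x.1)%:Z)
    = (\sum_(x in X) demand S E phi x)%N%:Z)%R.
Proof.
move=> injphi edegE; rewrite -[RHS]natz natr_sum; apply: eq_bigr => -[v i] _ /=.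
rewrite natz /demand -subzn /=; last first.
  have [/imsetP[h hS ->]|vS] := boolP (v \in phi @: S).
    rewrite (big_pred1 h) ?edeg_le // => x /=.
    by apply/andP/eqP=> [[xS /eqP/injphi->]|->].
  rewrite big_pred0 // => h; apply/andP=> -[hS /eqP hv].
  by case/negP: vS; rewrite -hv imset_f.
by congr (_ - _%:Z)%R; apply: eq_bigr => h _; rewrite edegE.
Qed.

(** [Rval] subtracts the term with [Pset], so dropping it preserves nonnegativity. *)
Lemma partial_embedding_good V0 c0 R0 phi :
  colgraph V0 c0 -> colsubgraph V0 c0 [set: W] c ->
  embeds G V0 c0 phi -> good G V0 c0 R0 phi (2 * s) D ->
  partial_embedding V0 (adj c0) phi.
Proof.
move=> [_ _ c0V] [_ c0c] [injphi phiG] goodphi.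
have c0E x y i : (adj c0 x y && (c x y == Some i)) = (c0 x y == Some i).
  rewrite /adj; case c0xy : (c0 x y) => [j|] //=; first by rewrite (c0c _ _ _ c0xy).
have edegE i h : edeg (adj c0) i h = cdeg c0 i h.
  by apply: eq_card => y; rewrite !inE c0E.
split=> // [x y xy|x y i xy cxy|X cX]; first by have /andP[] := c0V x y xy.
  by apply: phiG; apply/eqP; rewrite -c0E xy cxy eqxx.
have := goodphi X cX; rewrite /Rval.
rewrite (sum_demand X injphi edegE).
by move=> R_ge0; rewrite -lez_nat -subr_ge0 (le_trans R_ge0) // gerBl.
Qed.

Lemma good_partial_embedding E phi : E =2 adj c -> partial_embedding [set: W] E phi ->
  embeds G [set: W] c phi /\ good G [set: W] c [set: W] phi (2 * s) D.
Proof.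
move=> EE [injphi _ EG ext]; split.
  by split=> // x y i cxy; apply: (EG _ _ _ _ cxy); rewrite EE /adj cxy.
have edegE i h : edeg E i h = cdeg c i h.
  by apply: eq_card => y; rewrite !inE EE /adj; case: (c h y).
move=> X cX; have := ext X cX; rewrite /Rval.
have -> : Pset [set: W] c [set: W] phi = set0.
  apply/setP=> x; rewrite !inE /asb.
  case: ClassicalEpsilon.excluded_middle_informative => //= -[h [+ _ _]].
  by rewrite !inE.
rewrite set0I cards0 subr0 subr_ge0.
rewrite (sum_demand X injphi edegE).
by rewrite lez_nat.
Qed.

End Embedding.

Theorem theorem2p12 (s t D : nat) (V W : finType) (G : 'I_t -> rel V)
  (c : W -> W -> option 'I_t)
  (V0 : {set W}) (c0 : W -> W -> option 'I_t) (R0 : {set W})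
  (phi : W -> V) :
  1 <= s -> 1 <= t -> 3 <= D ->
  graph_family G -> s_joined s G ->
  colgraph [set: W] c -> mon_deg_le [set: W] c D ->
  #|W| + 6 * s * D <= #|V| ->
  colgraph V0 c0 -> colsubgraph V0 c0 [set: W] c -> rooted V0 c0 R0 ->
  (exists Ps : seq (seq W), path_constructible_with V0 c0 c Ps /\
     forall j, j < size Ps -> ell s D <= plength (nth [::] Ps j)) ->
  embeds G V0 c0 phi -> good G V0 c0 R0 phi (2 * s) D ->
  exists (R : {set W}) (phi' : W -> V),
    [/\ R0 \subset R, rooted [set: W] c R, embeds G [set: W] c phi',
        {in V0, phi' =1 phi} & good G [set: W] c R phi' (2 * s) D].
Proof.
move=> s_gt0 t_gt0 D3 famG joinedG colc degc card_le colc0 sub0 _ [Ps [pc len]] emb good0.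
have PE0 := partial_embedding_good degc colc0 sub0 emb good0.
have [phi1 phi1V PE1] :=
  embed_paths s_gt0 D3 (Ordinal t_gt0) famG joinedG colc degc card_le pc len PE0.
(* Vertices outside [V0] and on no path are isolated in [c]; they are placed last. *)
have [phi2 phi2V PE2] := embed_vertices s_gt0 D3 joinedG card_le (enum W) PE1.
have full : covered V0 Ps (size Ps) :|: [set x in enum W] = [set: W].
  by apply/setP=> x; rewrite !inE mem_enum orbT.
rewrite full in PE2.
have [_ _ edges _ _] := pc.
have [|emb' good'] := good_partial_embedding degc _ PE2.
  move=> x y; apply/orP/idP=> [xy|/edges[->|[j jPs xy]]]; [apply/edges|by left|right].
    case: xy => [xy|/hasP[j]]; first by left.
    by rewrite mem_iota => jPs xy; right; exists j.
  by apply/hasP; exists j; rewrite ?mem_iota.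
exists [set: W], phi2; split=> //; first exact: rooted_setT.
by move=> x xV; rewrite phi2V ?phi1V // inE /prior xV.
Qed.
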